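(* For every $p$ with $2<p\le\infty$ the following implication is not valid in general: ''if $A_{j,j}=A_{j,j}^{*}$ and $A_{j+1,j}=A_{j,j+1}>0$ for all $j\ge 0$, and if for some $z_0\in\mathbb{R}$ all solutions of $$A_{j,j-1}u_{j-1}+A_{j,j}u_j+A_{j,j+1}u_{j+1}=z\,u_j,\qquad j\ge 0,\qquad (\mathrm{I})$$ with $z=z_0$ belong to $l_n^p$, then for any $z\in\mathbb{C}$ all solutions of (I) belong to $l_n^p$.'' That is, for every such $p$ there exist $n\ge 1$, $n\times n$ complex matrix coefficients satisfying $A_{j,j}=A_{j,j}^{*}$ and $A_{j+1,j}=A_{j,j+1}>0$ for all $j\ge 0$, a number $z_0\in\mathbb{R}$ and a number $z\in\mathbb{C}$ such that all solutions of (I) with $z_0$ in place of $z$ belong to $l_n^p$, but some solution of (I) for this $z$ does not belong to $l_n^p$.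
   Context: The coefficients $A_{i,j}$ ($i,j\ge 0$, $|i-j|\le 1$) are $n\times n$ complex matrices, with $A_{i+1,i}$, $A_{i,i+1}$ invertible for all $i\ge 0$; in addition $A_{0,-1}=-E$, where $E$ is the $n\times n$ unit matrix. The symbol $*$ denotes Hermitian conjugation, and $B>0$ means that $B$ is Hermitian positive definite. The unknowns $u_j\in\mathbb{C}^n$ ($j\ge-1$) are column vectors. For $1\le p<\infty$, $l_n^p$ is the Banach space of sequences $u=(u_{-1},u_0,u_1,\dots)$ with $u_j\in\mathbb{C}^n$ and $\|u\|_p=(\sum_j|u_j|^p)^{1/p}<\infty$, where $|\cdot|$ is a fixed vector norm on $\mathbb{C}^n$; $l_n^\infty$ is the space of such sequences with $\|u\|_\infty=\sup_j|u_j|<\infty$. *)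

(* Defs.v *)
From mathcomp Require Import all_boot all_order all_algebra.
From mathcomp Require Import complex.
From mathcomp Require Import all_classical all_reals all_analysis.

Set Implicit Arguments.
Unset Strict Implicit.
Unset Printing Implicit Defensive.

Import Order.TTheory GRing.Theory Num.Theory.

Local Open Scope classical_set_scope.
Local Open Scope ring_scope.
Local Open Scope complex_scope.
Local Open Scope sesquilinear_scope.

Section BlockJacobi.
Variables (R : realType) (n : nat).
Implicit Types (B : 'M[R[i]]_n) (A : nat -> nat -> 'M[R[i]]_n).
Implicit Types (nu : 'cV[R[i]]_n -> R) (u : nat -> 'cV[R[i]]_n).

Definition hermitian_mx B : Prop := B = B^t*.

(* The order on R[i] is partial: 0 < w says that w is real and positive. *)
Definition hermitian_posdef B : Prop :=
  hermitian_mx B /\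
  forall v : 'cV[R[i]]_n, v != 0 -> 0 < (v^t* *m B *m v) 0 0.

(* normc is the modulus of a complex number, as an element of R. *)
Definition is_vector_norm nu : Prop :=
  [/\ forall v, 0 <= nu v,
      forall v, nu v = 0 -> v = 0,
      forall (a : R[i]) v, nu (a *: v) = Normc.normc a * nu v
    & forall v w, nu (v + w) <= nu v + nu w].

(* Sequences (u_{-1}, u_0, u_1, ...) are indexed by nat with a shift by one:
   u k stands for u_{k-1}. *)

(* Meaningful for 1 <= p <= +oo; the last branch is the case p = +oo. *)
Definition lp_norm nu (p : \bar R) u : \bar R :=
  (if p is r%:E then (\sum_(0 <= k <oo) (nu (u k) `^ r)%:E) `^ r^-1
   else ereal_sup (range (fun k => (nu (u k))%:E)))%E.

Definition in_lp nu (p : \bar R) u : Prop := (lp_norm nu p u < +oo)%E.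

(* A i j is A_{i,j}; only the entries with |i - j| <= 1 are ever used. *)
Definition offdiag_unit A : Prop :=
  forall j, A j.+1 j \in unitmx /\ A j j.+1 \in unitmx.

(* A_{j,j-1}, with the convention A_{0,-1} = -E. *)
Definition subdiag A (j : nat) : 'M[R[i]]_n :=
  if j is k.+1 then A k.+1 k else - 1%:M.

(* With the shift, u j, u j.+1, u j.+2 are u_{j-1}, u_j, u_{j+1}. *)
Definition is_solution A (z : R[i]) u : Prop :=
  forall j, subdiag A j *m u j + A j j *m u j.+1 + A j j.+1 *m u j.+2
            = z *: u j.+1.

End BlockJacobi.

(* Main.v *)
Require Import Defs.
From mathcomp Require Import all_boot all_order all_algebra.
From mathcomp Require Import complex.
From mathcomp Require Import all_classical all_reals all_analysis.
From mathcomp Require Import ring lra.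

(** A single scalar Jacobi matrix refutes the implication for all p > 2 at
    once: zero diagonal, off-diagonal entries 1, 2, 3, ..., and the spectral
    parameters 0 and 3i.

    At z = 0 the three-term recurrence only links indices of equal parity:
    with the index shift of [is_solution], |u_{k+2}| = k/(k+1) |u_k| for
    k >= 1.  Hence |u_k| behaves like k^(-1/2), so that every solution is
    bounded ([solution0_bounded]) and has summable r-th powers for r > 2
    ([solution0_summable]).  Summability is read off the
    recurrence by a Raabe type argument: Bernoulli's inequality turns
    (k/(k+1))^r into k/(k+r), and then the weighted terms k |u_k|^r decrease,
    along each parity class, by at least a fixed multiple of |u_k|^r
    ([kummer_step2]).

    At z = iy the substitution u_j = i^j v_j removes the complex numbers:
    (j+1) v_{j+1} = j v_{j-1} + y v_j, whose solution with v_0 = 1 has the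
    generating function (1+x)^((y-1)/2) / (1-x)^((y+1)/2) and grows like
    j^((y-1)/2).  For y = 3 this is (1+x)/(1-x)^2, so v_j = 2j+1.  That
    solution is unbounded, hence in no l^p ([growing_not_in_lp]), since each
    term of a sequence is bounded by its l^p norm ([le_lp_norm]). *)

Import Order.TTheory GRing.Theory Num.Theory.

Local Open Scope ring_scope.
Local Open Scope complex_scope.

(** Bernoulli's inequality for real exponents is Young's inequality
    ab <= a^r/r + b^q/q at a = 1 + x and b = 1. *)
Lemma bernoulli_powR (R : realType) (x r : R) :
  0 <= x -> 1 < r -> 1 + r * x <= (1 + x) `^ r.
Proof.
move=> x0 r1; have r0 : 0 < r by lra.
have q0 : 0 < (1 - r^-1)^-1 by rewrite invr_gt0 subr_gt0 invf_lt1.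
have rq : r^-1 + (1 - r^-1)^-1^-1 = 1 by rewrite invrK addrC subrK.
have x1 : 0 <= 1 + x by lra.
have := conjugate_powR x1 ler01 r0 q0 rq.
rewrite invrK powR1 mulr1 mul1r -(ler_pM2l r0).
have -> : r * ((1 + x) `^ r / r + (1 - r^-1)) = (1 + x) `^ r + r - 1.
  by field; rewrite gt_eqF.
by lra.
Qed.

Lemma powR_ratio_le (R : realType) (x r : R) :
  0 < x -> 1 < r -> (x / (x + 1)) `^ r <= x / (x + r).
Proof.
move=> x0 r1; have x1 : 0 < x^-1 by rewrite invr_gt0.
have -> : x / (x + 1) = (1 + x^-1)^-1 by field; rewrite !gt_eqF//; lra.
have -> : x / (x + r) = (1 + r * x^-1)^-1.
  by field; rewrite !gt_eqF//; lra.
have rx : 0 < 1 + r * x^-1 by rewrite addr_gt0// mulr_gt0//; lra.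
have -> : (1 + x^-1)^-1 `^ r = ((1 + x^-1) `^ r)^-1.
  apply/esym/mulr1_eq; rewrite -powRM ?invr_ge0; [|lra|lra].
  by rewrite mulfV ?powR1// gt_eqF//; lra.
rewrite lef_pV2 ?posrE//; first by apply: bernoulli_powR; lra.
by rewrite powR_gt0//; lra.
Qed.

(** Kummer's convergence test for a recurrence of step two: the hypothesis
    makes the sum of c * m k telescope, separately along the even and the odd
    indices, and each of the two telescopes leaves its initial term. *)
Lemma kummer_step2 (R : realType) (c : R) (d m : nat -> R) :
  (forall k, 0 <= d k * m k) ->
  (forall k, c * m k <= d k * m k - d k.+2 * m k.+2) ->
  forall N, c * (\sum_(0 <= k < N) m k) <= d 0 * m 0 + d 1 * m 1.
Proof.
move=> dm0 step N.
(* Keeping the two not yet telescoped terms makes the bound inductive. *)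
suff : c * (\sum_(0 <= k < N) m k) + (d N * m N + d N.+1 * m N.+1)
    <= d 0 * m 0 + d 1 * m 1.
  by have := dm0 N; have := dm0 N.+1; lra.
elim: N => [|N IH]; first by rewrite big_nil mulr0 add0r.
by rewrite big_nat_recr//= mulrDr; have := step N; lra.
Qed.

Section VectorNorm.
Variables (R : realType) (n : nat) (nu : 'cV[R[i]]_n -> R).
Hypothesis hnu : is_vector_norm nu.
Implicit Type u : nat -> 'cV[R[i]]_n.

(** This reduces failure of membership in l^p to unboundedness, for finite
    and infinite p alike. *)
Lemma le_lp_norm (p : \bar R) u k :
  (0 < p)%E -> ((nu (u k))%:E <= lp_norm nu p u)%E.
Proof.
have [nu0 _ _ _] := hnu; case: p => [r| |] //=; last first.
  by move=> _; apply: ereal_sup_ubound; exists k.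
rewrite lte_fin => r0.
have -> : (nu (u k))%:E = ((nu (u k) `^ r)%:E `^ r^-1)%E.
  by rewrite poweR_EFin -powRrM mulfV ?gt_eqF// powRr1.
have pos j : (0 <= (nu (u j) `^ r)%:E)%E by rewrite lee_fin powR_ge0.
apply: gt0_ler_poweR; first by rewrite invr_ge0 ltW.
- by rewrite in_itv /= pos leey.
- by rewrite in_itv /= leey andbT nneseries_ge0.
apply: le_trans (nneseries_lim_ge k.+1 _) => //.
by rewrite big_nat_recr//= leeDr// sume_ge0.
Qed.

Lemma in_lp_fin (r : R) u (M : R) :
  (forall N, \sum_(0 <= k < N) nu (u k) `^ r <= M) -> in_lp nu r%:E u.
Proof.
move=> le_M; apply: poweR_lty; apply: (@le_lt_trans _ _ M%:E); last exact: ltry.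
apply: lime_le.
  by apply: is_cvg_nneseries => k _ _; rewrite lee_fin powR_ge0.
by apply: nearW => N; rewrite sumEFin lee_fin.
Qed.

Lemma in_lp_pinfty u (M : R) : (forall k, nu (u k) <= M) -> in_lp nu +oo%E u.
Proof.
move=> le_M; apply: (@le_lt_trans _ _ M%:E); last exact: ltry.
by apply: ge_ereal_sup => _ [k _ <-]; rewrite lee_fin.
Qed.

Lemma vector_normN v : nu (- v) = nu v.
Proof.
have [_ _ nuZ _] := hnu.
by rewrite -scaleN1r nuZ normcN Normc.normc1 mul1r.
Qed.

Lemma vector_normMn v k : nu (k%:R *: v) = k%:R * nu v.
Proof.
have [_ _ nuZ _] := hnu.
by rewrite nuZ normcMn Normc.normc1.
Qed.

End VectorNorm.

Section Coefficients.
Variables (R : realType) (n : nat).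

Definition jacobi (i j : nat) : 'M[R[i]]_n :=
  if i == j then 0 else ((minn i j).+1%:R)%:M.

Lemma jacobi_diag j : jacobi j j = 0.
Proof. by rewrite /jacobi eqxx. Qed.

Lemma jacobi_sup j : jacobi j j.+1 = (j.+1%:R)%:M.
Proof. by rewrite /jacobi ltn_eqF// (minn_idPl _). Qed.

Lemma jacobi_sub j : jacobi j.+1 j = (j.+1%:R)%:M.
Proof. by rewrite /jacobi gtn_eqF// (minn_idPr _). Qed.

Lemma jacobi_offdiag_unit : offdiag_unit jacobi.
Proof.
move=> j; rewrite jacobi_sub jacobi_sup.
by rewrite unitmxE det_scalar unitfE expf_neq0// pnatr_eq0.
Qed.

Lemma posdef_scalar (k : nat) :
  hermitian_posdef ((k.+1%:R)%:M : 'M[R[i]]_n).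
Proof.
split=> [|v v0].
  by rewrite /hermitian_mx tr_scalar_mx map_scalar_mx /= conjC_nat.
rewrite mul_mx_scalar -scalemxAl mxE mulr_gt0 ?ltr0Sn// mxE.
have sq j : (v^t*%sesqui) 0 j * v j 0 = `|v j 0| ^+ 2.
  by rewrite !mxE mulrC -normCK.
rewrite lt_def; apply/andP; split; last first.
  by apply: sumr_ge0 => j _; rewrite sq exprn_ge0.
apply: contra v0 => /eqP s0; apply/eqP/colP => j; rewrite [RHS]mxE.
have /psumr_eq0P/(_ s0 j isT) : forall j, true ->
    0 <= (v^t*%sesqui) 0 j * v j 0 by move=> i _; rewrite sq exprn_ge0.
by rewrite sq => /eqP; rewrite expf_eq0 normr_eq0 /= => /eqP.
Qed.

(** The case j = 0 is separate because of the convention A_{0,-1} = -E. *)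
Lemma jacobi_solutionP (z : R[i]) (u : nat -> 'cV[R[i]]_n) :
  is_solution jacobi z u <->
  u 2 = z *: u 1 + u 0 /\
  forall j, j.+2%:R *: u j.+3 = z *: u j.+2 - j.+1%:R *: u j.+1.
Proof.
have E j v w : subdiag jacobi j *m v + jacobi j j *m w
    = (if j is k.+1 then k.+1%:R *: v else - v).
  rewrite jacobi_diag mul0mx addr0; case: j => [|j] /=.
    by rewrite mulNmx mul1mx.
  by rewrite jacobi_sub mul_scalar_mx.
split=> [sol|[sol0 sol] j].
  split=> [|j].
    have := sol 0; rewrite E jacobi_sup mul_scalar_mx scale1r => <-.
    by rewrite addrAC addNr add0r.
  have := sol j.+1; rewrite E jacobi_sup mul_scalar_mx => <-.
  by rewrite addrC addKr.
rewrite E jacobi_sup mul_scalar_mx; case: j => [|j].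
  by rewrite scale1r sol0 addrC addrK.
by rewrite sol addrC subrK.
Qed.

Section AtZero.
Variables (nu : 'cV[R[i]]_n -> R) (u : nat -> 'cV[R[i]]_n).
Hypotheses (hnu : is_vector_norm nu) (sol : is_solution jacobi 0%:C u).

Lemma norm_solution0 j : nu (u j.+3) = j.+1%:R / j.+2%:R * nu (u j.+1).
Proof.
have [_ /(_ j)] := (jacobi_solutionP _ _).1 sol.
rewrite scale0r sub0r => /(congr1 nu).
rewrite vector_normN// !vector_normMn// => e.
by rewrite mulrAC -e mulrC mulKf// pnatr_eq0.
Qed.

Lemma solution0_bounded : in_lp nu +oo%E u.
Proof.
have [nu0 _ _ _] := hnu; pose M := nu (u 0) + nu (u 1).
apply: (@in_lp_pinfty _ _ _ _ M) => k.
have [e _] := (jacobi_solutionP _ _).1 sol.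
suff H j : nu (u j.+1) <= M /\ nu (u j.+2) <= M.
  by case: k => [|k]; [rewrite lerDl | have [] := H k].
elim: j => [|j [IH1 IH2]].
  by rewrite e scale0r add0r lerDl lerDr.
split=> //; apply: le_trans IH1; rewrite norm_solution0 ler_piMl//.
by rewrite ler_pdivrMr ?ltr0Sn// mul1r ler_nat.
Qed.

(** Raabe's test: with x = k + 1 and m k = nu (u k.+1)^r, two steps
    take the weighted term x m k to at most (x+2) x/(x+r) m k, so they cost at
    least (r-2) x/(x+r) m k >= (r-2)/(1+r) m k.  This is where r > 2 enters. *)
Lemma solution0_summable (r : R) : 2 < r -> in_lp nu r%:E u.
Proof.
move=> r2; have [nu0 _ _ _] := hnu.
pose m k := nu (u k.+1) `^ r.
have m0 k : 0 <= m k by exact: powR_ge0.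
have c0 : 0 < (r - 2) / (1 + r) by rewrite divr_gt0//; lra.
have step k : (r - 2) / (1 + r) * m k <= k.+1%:R * m k - k.+3%:R * m k.+2.
  have -> : m k.+2 = (k.+1%:R / k.+2%:R) `^ r * m k.
    by rewrite /m norm_solution0 powRM.
  rewrite mulrA -mulrBl ler_wpM2r//.
  have : 1 <= k.+1%:R :> R by rewrite ler1n.
  rewrite -[k.+3](addn2 k.+1) -[k.+2]addn1 !natrD.
  move: (k.+1%:R : R) => x x1.
  have : (x + 2) * (x / (x + 1)) `^ r <= (x + 2) * (x / (x + r)).
    by rewrite ler_wpM2l ?powR_ratio_le//; lra.
  suff : (r - 2) / (1 + r) <= x - (x + 2) * (x / (x + r)) by lra.
  have -> : x - (x + 2) * (x / (x + r)) = (r - 2) * (x / (x + r)).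
    by field; rewrite gt_eqF//; lra.
  rewrite ler_wpM2l//; first lra.
  rewrite ler_pdivlMr; last lra.
  rewrite mulrC ler_pdivrMr; last lra.
  by rewrite mulrDr mulr1 lerD2l ler_peMl//; lra.
have dm0 k : 0 <= k.+1%:R * m k by rewrite mulr_ge0.
apply: (@in_lp_fin _ _ _ _ _ (nu (u 0) `^ r +
    (1 * m 0 + 2 * m 1) / ((r - 2) / (1 + r)))) => N.
apply: (@le_trans _ _ (\sum_(0 <= k < N.+1) nu (u k) `^ r)).
  by rewrite big_nat_recr//= lerDl powR_ge0.
(* u 0 is split off: the recurrence of ratio k/(k+1) starts at index 1. *)
rewrite big_nat_recl//= lerD2l ler_pdivlMr// mulrC.
exact: (kummer_step2 R _ (fun k => k.+1%:R) m dm0 step).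
Qed.

Lemma solution0_in_lp (p : \bar R) : (2%:E < p)%E -> in_lp nu p u.
Proof.
case: p => [r| |] //; first by move=> /solution0_summable.
by move=> _; exact: solution0_bounded.
Qed.

End AtZero.

(** The sequence u_j = i^j (2j+1) e with u_{-1} = 0: up to the twist i^j, the
    Meixner-Pollaczek polynomials (orthogonal for this Jacobi matrix) at the
    point 3i. *)
Definition growing (e : 'cV[R[i]]_n) (k : nat) : 'cV[R[i]]_n :=
  if k is j.+1 then ('i%C ^+ j * (j.*2.+1)%:R) *: e else 0.

Lemma growing_solution e : is_solution jacobi (3 * 'i%C) (growing e).
Proof.
apply/jacobi_solutionP; split=> [|j] /=.
  rewrite addr0 scalerA; congr (_ *: _).
  by rewrite expr0 expr1 mul1r mulr1 mulrC.
rewrite !scalerA -scalerBl; congr (_ *: _).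
have i2 : 'i%C ^+ j.+2 = - 'i%C ^+ j :> R[i].
  by rewrite -addn2 exprD sqr_i mulrN1.
have -> : 3 * 'i%C * ('i%C ^+ j.+1 * (j.+1).*2.+1%:R)
    = 3 * (j.+1).*2.+1%:R * 'i%C ^+ j.+2 :> R[i].
  by rewrite (exprS _ j.+1); ring.
rewrite i2 -!muln2 -!natr1 !natrM -!natr1; ring.
Qed.

Lemma norm_growing nu e j :
  is_vector_norm nu -> nu (growing e j.+1) = (j.*2.+1)%:R * nu e.
Proof.
move=> hnu; have [_ _ nuZ _] := hnu.
rewrite nuZ Normc.normcM normcMn Normc.normc1; congr (_ * _).
have -> : Normc.normc ('i%C ^+ j : R[i]) = 1; last by rewrite mul1r.
elim: j => [|j IH]; first by rewrite expr0 Normc.normc1.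
by rewrite exprS Normc.normcM IH mulr1 /= expr0n expr1n add0r sqrtr1.
Qed.

Lemma growing_not_in_lp nu (p : \bar R) e :
  is_vector_norm nu -> (0 < p)%E -> e != 0 -> ~ in_lp nu p (growing e).
Proof.
move=> hnu p0 e0 lpu; have [nu0 nu_eq0 _ _] := hnu.
have ne : 0 < nu e.
  by rewrite lt_def nu0 andbT; apply: contra e0 => /eqP/nu_eq0 ->.
have le_lp k := le_lp_norm _ _ _ hnu _ (growing e) k p0.
have fin : lp_norm nu p (growing e) \is a fin_num.
  by rewrite ge0_fin_numE// (le_trans _ (le_lp 0))// lee_fin.
set S := fine (lp_norm nu p (growing e)).
have le_S j : j%:R * nu e <= S.
  have := le_lp j.+1; rewrite -(fineK fin) lee_fin norm_growing//.
  apply: le_trans; rewrite ler_wpM2r// ler_nat -addnn -addnS leq_addr//.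
have := le_S (Num.bound (S / nu e)); apply/negP; rewrite -ltNge -ltr_pdivrMr//.
by apply: archi_boundP; rewrite divr_ge0// (le_trans _ (le_S 0))// mul0r.
Qed.

End Coefficients.

Theorem theorem4 (R : realType)
    (nu : forall n : nat, 'cV[R[i]]_n -> R)
    (hnu : forall n : nat, is_vector_norm (nu n))
    (p : \bar R) (hp : (2%:E < p)%E) :
  exists (n : nat) (A : nat -> nat -> 'M[R[i]]_n) (z0 : R) (z : R[i]),
    [/\ (1 <= n)%N,
        offdiag_unit A,
        (forall j : nat, hermitian_mx (A j j)),
        (forall j : nat, A j.+1 j = A j j.+1 /\ hermitian_posdef (A j j.+1))
      & (forall u : nat -> 'cV[R[i]]_n,
           is_solution A z0%:C u -> in_lp (nu n) p u) /\
        (exists u : nat -> 'cV[R[i]]_n,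
           is_solution A z u /\ ~ in_lp (nu n) p u)].
Proof.
exists 1, (jacobi R 1), 0, (3 * 'i%C); split=> //.
- exact: jacobi_offdiag_unit.
- by move=> j; rewrite jacobi_diag /hermitian_mx trmx0 map_mx0.
- by move=> j; rewrite jacobi_sub jacobi_sup; split=> //; exact: posdef_scalar.
split=> [u sol|]; first exact: solution0_in_lp.
exists (growing R 1 (const_mx 1)); split; first exact: growing_solution.
apply: growing_not_in_lp => //; first by apply: lt_trans hp; rewrite lte_fin.
by apply/eqP => /colP/(_ 0)/eqP; rewrite !mxE oner_eq0.
Qed.
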